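(* Let $G$ be a finite nilpotent group of order $n$, and let $H\neq\{e\}$ be a subgroup of $G$ of order $m$. Then $\Gamma_{G,H}\cong\Gamma_{\mathbb{Z}_n,\mathbb{Z}_m}$ (isomorphism of graphs), where $\mathbb{Z}_m$ denotes the unique subgroup of order $m$ of the cyclic group $\mathbb{Z}_n$.
   Context: For a finite group $G$ with identity $e$ and a subgroup $H\neq\{e\}$ of $G$, the generalized non-coprime graph $\Gamma_{G,H}$ is the simple undirected graph with vertex set $G\setminus\{e\}$ in which two distinct vertices $a,b$ are adjacent if and only if $\gcd(|a|,|b|)\neq 1$ and ($a\in H$ or $b\in H$), where $|a|$ denotes the order of the element $a$. *)

(* Defs.v *)
From mathcomp Require Import all_boot all_order all_algebra all_fingroup all_solvable.

Set Implicit Arguments.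
Unset Strict Implicit.
Unset Printing Implicit Defensive.

Local Open Scope group_scope.

Record sgraph := SGraph {
  vertex :> finType;
  adj : rel vertex;
  adj_sym : symmetric adj;
  adj_irr : irreflexive adj
}.

Definition sgraph_iso (X Y : sgraph) : Prop :=
  exists2 f : X -> Y, bijective f & forall x y, adj (f x) (f y) = adj x y.

Section GeneralizedNonCoprimeGraph.

Variables (gT : finGroupType) (G H : {group gT}).

Definition ncg_vertex := {x : gT | x \in G^#}.

Definition ncg_adj : rel ncg_vertex := fun a b =>
  [&& a != b, gcdn #[val a] #[val b] != 1%N & (val a \in H) || (val b \in H)].

Lemma ncg_adj_sym : symmetric ncg_adj.
Proof. by move=> a b; rewrite /ncg_adj eq_sym gcdnC orbC. Qed.

Lemma ncg_adj_irr : irreflexive ncg_adj.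
Proof. by move=> a; rewrite /ncg_adj eqxx. Qed.

Definition noncoprime_graph : sgraph := SGraph ncg_adj_sym ncg_adj_irr.

End GeneralizedNonCoprimeGraph.

(* For m dividing n, the subgroup of order m of the additive group Zp n is   *)
(* generated by the class of n / m; see card_Zp_subgroup and                 *)
(* Zp_subgroup_unique.                                                       *)
Definition Zp_subgroup (n m : nat) : {group 'Z_n} :=
  <[((n %/ m)%:R)%R : 'Z_n]>%G.

Lemma Zp_subgroup_sub n m : 1 < n -> Zp_subgroup n m \subset Zp n.
Proof. by move=> n_gt1; rewrite /Zp n_gt1 subsetT. Qed.

Lemma card_Zp_subgroup n m : 1 < n -> m %| n -> #|Zp_subgroup n m| = m.
Proof.
move=> n_gt1 mn; have n_gt0 := ltnW n_gt1.
have m_gt0 := dvdn_gt0 n_gt0 mn.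
have o1 : #[Zp1 : 'Z_n] = n by rewrite order_Zp1 Zp_cast.
have -> : #|Zp_subgroup n m| = #[(Zp1 : 'Z_n) ^+ (n %/ m)].
  by rewrite FinRing.zmodXgE orderE.
by rewrite orderXdiv o1 ?dvdn_div // divnA // mulKn.
Qed.

Lemma Zp_subgroup_unique n m (K : {group 'Z_n}) :
  1 < n -> m %| n -> K \subset Zp n -> #|K| = m -> K = Zp_subgroup n m.
Proof.
move=> n_gt1 mn KZ cK; apply/group_inj.
have cycZ : cyclic (Zp n).
  apply/cyclicP; exists (Zp1 : 'Z_n).
  by rewrite /Zp n_gt1 -Zp_cycle.
have := eq_subG_cyclic cycZ KZ (Zp_subgroup_sub m n_gt1).
by rewrite cK card_Zp_subgroup // eqxx => /eqP.
Qed.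

(* Main.v *)
Require Import Defs.
From mathcomp Require Import all_boot all_order all_algebra all_fingroup all_solvable.

(** Adjacency of two distinct vertices depends only on their types, the type
    of x being the pair (does x lie in H, which primes divide #[x]): two orders
    are non-coprime iff they share a prime.  So it is enough to have a bijection
    between the vertex sets that preserves types, and such a bijection exists as
    soon as every type is realised equally often on both sides
    ([type_preserving_bijection]).

    In a nilpotent group G the elements whose order involves only primes of a
    set pi form the normal Hall subgroup 'O_pi(G), hence their number is the
    pi-part of #|G| ([card_pi_elements]).  This counts the elements whose set of
    primes is *contained* in a given set; Moebius inversion on the lattice of
    sets of primes ([card_fiber_of_card_downset]) then shows that the number of
    elements whose set of primes is *equal* to a given set is determined by
    #|G|.  As H is nilpotent too, this also holds for H, and by subtraction for
    G :\: H.  Hence the graph of a nilpotent group depends only on #|G| and #|H|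
    ([noncoprime_graph_nilpotent]), and 'Z_n is one nilpotent group of order n. *)

Local Open Scope group_scope.

(** Enumerate each fibre on both sides and match equal ranks. *)
Lemma type_preserving_bijection (T1 T2 K : finType)
    (k1 : T1 -> K) (k2 : T2 -> K) :
  (forall c, #|[pred x | k1 x == c]| = #|[pred y | k2 y == c]|) ->
  exists2 f : T1 -> T2, bijective f & forall x, k2 (f x) = k1 x.
Proof.
move=> eqk.
have card_fibers (T : finType) (k : T -> K) :
    #|T| = \sum_c #|[pred x | k x == c]|.
  rewrite -sum1_card (partition_big k predT) //=.
  by apply: eq_bigr => c _; rewrite sum1_card; apply: eq_card.
have eqT : #|T1| = #|T2|.
  by rewrite (card_fibers _ k1) (card_fibers _ k2); apply: eq_bigr.
(* Ranks are matched by [nth], whose default value y0 needs T2 to be inhabited. *)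
have [y0 _ | T2_empty] := pickP [pred y : T2 | true]; last first.
  have T1_empty (x : T1) : False.
    by have := card0_eq (etrans eqT (eq_card0 T2_empty)) x; rewrite inE.
  exists (fun x => match T1_empty x with end) => [|x]; last by case: (T1_empty x).
  exists (fun y => match elimF idP (T2_empty y) isT with end) => [x | y].
    by case: (T1_empty x).
  by have := T2_empty y.
pose fib1 c := enum [pred x | k1 x == c].
pose fib2 c := enum [pred y | k2 y == c].
have size_fib c : size (fib1 c) = size (fib2 c) by rewrite -!cardE eqk.
pose f x := nth y0 (fib2 (k1 x)) (index x (fib1 (k1 x))).
have rank_lt x : index x (fib1 (k1 x)) < size (fib2 (k1 x)).
  by rewrite -size_fib index_mem mem_enum inE.
have k2f x : k2 (f x) = k1 x.
  by have := mem_nth y0 (rank_lt x); rewrite mem_enum inE => /eqP.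
exists f => //; apply: inj_card_bij; last by rewrite eqT.
move=> x x' eqf; have eqkx : k1 x = k1 x' by rewrite -!k2f eqf.
move/eqP: eqf; rewrite /f eqkx nth_uniq ?enum_uniq ?rank_lt //; last first.
  by rewrite -eqkx rank_lt.
by move/eqP/(index_inj x); apply; rewrite mem_enum inE ?eqkx.
Qed.

(** Moebius inversion on a Boolean lattice, by induction on #|A|: the down-set
    of A is the fibre over A together with the fibres over the proper subsets
    of A. *)
Lemma card_fiber_of_card_downset (I T1 T2 : finType) (D1 : {set T1})
    (D2 : {set T2}) (k1 : T1 -> {set I}) (k2 : T2 -> {set I}) :
  (forall A : {set I}, #|[set x in D1 | k1 x \subset A]|
           = #|[set y in D2 | k2 y \subset A]|) ->
  forall A, #|[set x in D1 | k1 x == A]| = #|[set y in D2 | k2 y == A]|.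
Proof.
move=> eq_down A; have [s] := ubnP #|A|; elim: s A => // s IHs A ltAs.
have downE (T : finType) (D : {set T}) (k : T -> {set I}) :
  #|[set x in D | k x \subset A]|
    = (#|[set x in D | k x == A]|
       + \sum_(B : {set I} | (B \subset A) && (B != A))
            #|[set x in D | k x == B]|)%N.
  rewrite -(bigD1 A (P := fun B => B \subset A)
               (F := fun B => #|[set x in D | k x == B]|)) //=.
  rewrite -sum1_card (partition_big k (fun B => B \subset A)) => [|x]; last first.
    by rewrite inE => /andP[].
  apply: eq_bigr => B sBA; rewrite -sum1_card; apply: eq_bigl => x.
  by rewrite !inE; case: eqP => [->|]; rewrite ?andbF ?sBA ?andbT.
have := eq_down A; rewrite !downE.
rewrite (eq_bigr (fun B => #|[set y in D2 | k2 y == B]|)).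
  by move/addIn.
move=> B /andP[sBA neBA]; apply: IHs.
have ltBA : B \proper A by rewrite properEneq neBA.
exact: leq_trans (proper_card ltBA) _.
Qed.

(** By nilpotency G has a normal Hall pi-subgroup 'O_pi(G); being normal, it
    contains every pi-element of G, and all its elements are pi-elements. *)
Lemma card_pi_elements (gT : finGroupType) (G : {group gT}) (pi : nat_pred) :
  nilpotent G -> #|[set x in G^# | pi.-elt x]| = (#|G|`_pi).-1.
Proof.
move=> nilG; have hallO := nilpotent_pcore_Hall pi nilG.
rewrite -(card_Hall hallO) (cardsD1 1 'O_pi(G)) group1 /=.
apply: eq_card => x; rewrite !inE -andbA; congr (_ && _).
have [Gx | G'x] := boolP (x \in G).
  by rewrite (mem_normal_Hall hallO (pcore_normal _ _) Gx).
by apply/esym/negbTE; apply: contra G'x; apply/subsetP/pcore_sub.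
Qed.

(** The bound N makes this a set over a finite type, as the inversion lemma
    requires; no prime is lost as long as #[x] <= N. *)
Definition prime_support (gT : finGroupType) (N : nat) (x : gT) :
    {set 'I_N.+1} :=
  [set p : 'I_N.+1 | (p : nat) \in \pi(#[x])].

Arguments prime_support {gT} N x.

Section PrimeSupport.

Variables (gT : finGroupType) (N : nat) (x : gT).
Hypothesis ox : #[x] <= N.

Let prime_bound p : p \in \pi(#[x]) -> p < N.+1.
Proof.
rewrite mem_primes ltnS => /and3P[_ x_gt0 p_dv].
exact: leq_trans (dvdn_leq x_gt0 p_dv) ox.
Qed.

(** Turns the down-sets of prime supports into sets of pi-elements, whose
    number in a nilpotent group is the order of a Hall subgroup. *)
Lemma prime_support_subset (A : {set 'I_N.+1}) :
  (prime_support N x \subset A)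
    = ([pred p | p \in map val (enum A)] : nat_pred).-elt x.
Proof.
apply/subsetP/pgroupP => [sA p p_pr p_dv | piA p].
  have p_x : p \in \pi(#[x]) by rewrite mem_primes p_pr order_gt0.
  apply/mapP; exists (Ordinal (prime_bound p p_x)) => //.
  by rewrite mem_enum sA ?inE.
rewrite inE mem_primes => /and3P[p_pr _ p_dv].
by have /mapP[q + /val_inj->] := piA _ p_pr p_dv; rewrite mem_enum.
Qed.

Lemma noncoprime_orders (y : gT) :
  (gcdn #[x] #[y] != 1%N)
    = (prime_support N x :&: prime_support N y != set0).
Proof.
have := coprime_has_primes (order_gt0 x) (order_gt0 y).
rewrite /coprime => ->; rewrite negbK; apply/hasP/set0Pn => [[p p_y p_x] | [p]].
  by exists (Ordinal (prime_bound p p_x)); rewrite !inE p_x p_y.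
by rewrite !inE => /andP[p_x p_y]; exists (p : nat).
Qed.

End PrimeSupport.

Lemma order_leq_card (gT : finGroupType) (G : {group gT}) (x : gT) :
  x \in G -> #[x] <= #|G|.
Proof. by move=> /order_dvdG; apply: dvdn_leq. Qed.

(** Both sides have equal down-set counts, namely one less than the pi-part of
    the common order, so Moebius inversion applies.  The bound N is left free
    so that a group and its subgroup can share one type of supports. *)
Lemma card_prime_support_fiber (gT1 gT2 : finGroupType) (N : nat)
    (K1 : {group gT1}) (K2 : {group gT2}) :
    nilpotent K1 -> nilpotent K2 -> #|K1| = #|K2| -> #|K1| <= N ->
  forall A, #|[set x in K1^# | prime_support N x == A]|
          = #|[set y in K2^# | prime_support N y == A]|.
Proof.
move=> nil1 nil2 oK leKN; apply: card_fiber_of_card_downset => A.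
have downE (gT : finGroupType) (K : {group gT}) : #|K| <= N ->
  [set x in K^# | prime_support N x \subset A]
    = [set x in K^# | ([pred p | p \in map val (enum A)] : nat_pred).-elt x].
  move=> leN; apply/setP => x; rewrite !inE; case Kx: (x \in K); last first.
    by rewrite !andbF.
  by rewrite prime_support_subset // (leq_trans (order_leq_card _ _ _ Kx)).
by rewrite !downE -?oK // !card_pi_elements // oK.
Qed.

Definition vertex_type (gT : finGroupType) (G H : {group gT}) (N : nat)
    (x : ncg_vertex G) : bool * {set 'I_N.+1} :=
  (val x \in H, prime_support N (val x)).

Arguments vertex_type {gT G} H N x.

(** Vertices outside H are counted by difference: G :\: H is not a group, but
    the elements with a given support can be counted in G and in H. *)
Lemma card_vertex_type (gT : finGroupType) (G H : {group gT}) (N : nat)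
    (c : bool * {set 'I_N.+1}) : H \subset G ->
  #|[pred x : ncg_vertex G | vertex_type H N x == c]| =
    if c.1 then #|[set x in H^# | prime_support N x == c.2]|
    else #|[set x in G^# | prime_support N x == c.2]|
         - #|[set x in H^# | prime_support N x == c.2]|.
Proof.
case: c => b A sHG /=.
set GA := [set x in G^# | _]; set HA := [set x in H^# | _].
have sHA : HA \subset GA.
  apply/subsetP => x; rewrite !inE => /andP[/andP[-> /(subsetP sHG)->]].
  by move->.
have -> : #|[pred x : ncg_vertex G | vertex_type H N x == (b, A)]|
          = #|if b then HA else GA :\: HA|.
  rewrite -(card_image val_inj); apply: eq_card => x.
  have -> : (x \in if b then HA else GA :\: HA)
            = [&& x \in G^#, (x \in H) == b & prime_support N x == A].
    have := subsetP sHG x; case: (b); rewrite !inE;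
      case: (x \in H); case: (x \in G); case: (x == 1); case: (_ == A) => //;
      by move/(_ isT).
  apply/imageP/and3P => [[y + ->] | [Gx bx Ax]].
    by rewrite inE xpair_eqE => /andP[? ?]; split=> //; apply: valP.
  by exists (exist _ x Gx); rewrite // inE xpair_eqE bx.
by case: (b); rewrite // cardsD (setIidPr sHA).
Qed.

(** A type-preserving bijection of the vertices is an isomorphism, since types
    and distinctness determine adjacency. *)
Theorem noncoprime_graph_nilpotent (gT1 gT2 : finGroupType)
    (G1 H1 : {group gT1}) (G2 H2 : {group gT2}) :
    nilpotent G1 -> nilpotent G2 -> H1 \subset G1 -> H2 \subset G2 ->
    #|G1| = #|G2| -> #|H1| = #|H2| ->
  sgraph_iso (noncoprime_graph G1 H1) (noncoprime_graph G2 H2).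
Proof.
move=> nil1 nil2 sHG1 sHG2 oG oH; pose N := #|G1|.
have eq_types c : #|[pred x : ncg_vertex G1 | vertex_type H1 N x == c]|
                = #|[pred y : ncg_vertex G2 | vertex_type H2 N y == c]|.
  have eqG := card_prime_support_fiber _ _ N _ _ nil1 nil2 oG (leqnn _).
  have eqH := card_prime_support_fiber _ _ N _ _ (nilpotentS sHG1 nil1)
                (nilpotentS sHG2 nil2) oH (subset_leq_card sHG1).
  by rewrite !card_vertex_type // eqG eqH.
have [f bij_f fE] := type_preserving_bijection _ _ _ _ _ eq_types.
exists f => // x y; rewrite /= /ncg_adj (inj_eq (bij_inj bij_f)).
have [[Hfx sfx] [Hfy sfy]] := (fE x, fE y).
have Gx : val x \in G1 by have := valP x; rewrite inE => /andP[].
have Gfx : val (f x) \in G2 by have := valP (f x); rewrite inE => /andP[].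
have le_x : #[val x] <= N by apply: order_leq_card.
have le_fx : #[val (f x)] <= N by rewrite /N oG; apply: order_leq_card.
by rewrite (noncoprime_orders _ N _ le_x) (noncoprime_orders _ N _ le_fx)
           Hfx Hfy sfx sfy.
Qed.

Theorem theorem3p1 (gT : finGroupType) (G H : {group gT}) (n m : nat)
  (nilG : nilpotent G) (oG : #|G| = n)
  (sHG : H \subset G) (ntH : H :!=: 1) (oH : #|H| = m) :
  sgraph_iso (noncoprime_graph G H)
             (noncoprime_graph (Zp_group n) (Zp_subgroup n m)).
Proof.
have n_gt1 : 1 < n.
  by rewrite -oG (leq_trans _ (subset_leq_card sHG)) // cardG_gt1.
have m_dv_n : m %| n by rewrite -oG -oH cardSg.
apply: noncoprime_graph_nilpotent => //.
- exact: abelian_nil (abelianS (subsetT _) (Zp_abelian _)).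
- exact: Zp_subgroup_sub.
- by rewrite oG card_Zp // ltnW.
- by rewrite oH card_Zp_subgroup.
Qed.
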